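(* Let $H$ be a separable infinite-dimensional complex Hilbert space, let $I$ be the identity operator on $H$, let $K$ be a non-negative (self-adjoint) compact operator on $H$ of infinite rank, and let $\boldsymbol{i}=\sqrt{-1}$. Then the operator $I-K-\boldsymbol{i}K$ is not a complex linear combination of four orthoprojections, i.e. there do not exist complex numbers $c_1,\dots,c_4$ and orthoprojections $P_1,\dots,P_4$ on $H$ with $I-K-\boldsymbol{i}K=c_1P_1+c_2P_2+c_3P_3+c_4P_4$.
   Context: An orthoprojection on $H$ is a bounded operator $P$ on $H$ with $P=P^*=P^2$. Non-negative means $(Kx,x)\ge 0$ for all $x\in H$. *)

(* Defs.v *)
(* MathComp-Analysis, with R[i] from real-closed as the complex numbers. *)
From mathcomp Require Import all_boot all_order all_algebra.
From mathcomp Require Import complex.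
From mathcomp Require Import all_classical all_reals all_analysis.
Set Implicit Arguments.
Unset Strict Implicit.
Unset Printing Implicit Defensive.
Import Order.TTheory GRing.Theory Num.Theory.
Import numFieldNormedType.Exports.
Local Open Scope classical_set_scope.
Local Open Scope ring_scope.

Section Operators.
Variables (R : realType) (H : completeNormedModType R[i]).

Definition separable : Prop := exists2 D : set H, countable D & dense D.

(* For a linear subspace A this says exactly that A is finite dimensional. *)
Definition finitely_spanned (A : set H) : Prop :=
  exists n (e : 'I_n -> H), forall x, A x ->
    exists a : 'I_n -> R[i], x = \sum_(k < n) a k *: e k.

Definition infinite_dimensional : Prop := ~ finitely_spanned [set: H].

Definition infinite_rank (T : {linear H -> H}) : Prop :=
  ~ finitely_spanned (range T).

Definition bounded_operator (T : {linear H -> H}) : Prop :=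
  exists M : R[i], forall x, `|T x| <= M * `|x|.

Definition compact_operator (T : {linear H -> H}) : Prop :=
  forall A : set H, bounded_set A -> precompact (T @` A).

(* Inner products are linear in the first argument and conjugate-linear in the
   second. A complete normed space over R[i] together with such a form
   inducing its norm is a complex Hilbert space. *)
Variable dot : {dot H for Num.conj}.

Definition induces_norm : Prop := forall x, `|x| ^+ 2 = dot x x.

Definition is_adjoint (T S : {linear H -> H}) : Prop :=
  forall x y, dot (T x) y = dot x (S y).

Definition selfadjoint (T : {linear H -> H}) : Prop := is_adjoint T T.

(* In the order of R[i], 0 <= z means that z is real and nonnegative. *)
Definition nonnegative (T : {linear H -> H}) : Prop :=
  forall x, 0 <= dot (T x) x.

Definition orthoprojection (P : {linear H -> H}) : Prop :=
  [/\ bounded_operator P, selfadjoint P & forall x, P (P x) = P x].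

End Operators.

Arguments separable {R} H.
Arguments infinite_dimensional {R} H.

(* Main.v *)
Require Import Defs.
From HB Require Import structures.
From mathcomp Require Import all_boot all_order all_algebra.
From mathcomp Require Import complex ring lra.
From mathcomp Require Import all_classical all_reals all_analysis.
Import Order.TTheory GRing.Theory Num.Theory.
Import numFieldNormedType.Exports.
Set Implicit Arguments.
Unset Strict Implicit.
Unset Printing Implicit Defensive.
Local Open Scope classical_set_scope.
Local Open Scope ring_scope.

(** Suppose [I - K - iK = c_1 P_1 + ... + c_4 P_4]. Comparing selfadjoint and
    skew-adjoint parts gives [I = \sum d_j P_j] and [K = - \sum (Im c_j) P_j]
    with real [d_j = Re c_j - Im c_j]. Some [d_j] is nonzero, and the two
    identities can be combined to cancel that [P_j]: [K + sI] is a real linear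
    combination of three orthoprojections. Writing each of them as [(1 + U)/2]
    with [U] a symmetry (a selfadjoint involution), and moving one symmetry to
    the left, one gets
      [B := K + gV = t + a U_1 + b U_2],  with [g >= 0].
    This forces [K] to have finite rank, because the two sides of the equation
    have incompatible spectra.

    Right-hand side: the commutator [W = U_1 U_2 - U_2 U_1] anticommutes with
    [U_1] and with [U_2], hence with [B - t]. So [W] sends an eigenvector of [B]
    for [l] to one for [2t - l] ([commutator_reflects]), unless it kills it,
    which happens only for the four values [t +- a +- b]
    ([commuting_eigenvalue]): up to these, the spectrum is symmetric about [t].

    Left-hand side: [B] is a nonnegative compact perturbation of [gV], whose
    spectrum is contained in [{-g, g}]. So the eigenvalues of [B] can accumulate
    only at [-g] and [g] ([far_eigenvalues_finite]), and only from above: they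
    are all at least [-g], and only finitely many lie in [[0, g[]
    ([gap_eigenvalues_finite]). If [K] has infinite rank then infinitely many
    eigenvalues differ from [-g] and [g] ([eigenvalues_infinite]). Reflecting
    about [t] would turn accumulation from above into accumulation from below.
    Quantitatively, some eigenvalue is [s + u] and its mirror image is
    [s' + u'] with [s, s'] in [{-g, g}] and [u, u' >= 0] as small as desired;
    then [s + s' + u + u' = 2t] forces [s + s' = 2t], so [u = u' = 0],
    although [s + u] was chosen different from [-g] and [g].

    All coefficients are real once the two parts have been separated, so this
    is carried out in the real vector space underlying the Hilbert space, with
    the real part of the scalar product. *)

(** * Real inner product spaces *)

Record inner_product (R : realType) (E : lmodType R) := InnerProduct {
  ip :> E -> E -> R;
  ipC : forall x y, ip x y = ip y x;
  ipDl : forall x y z, ip (x + y) z = ip x z + ip y z;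
  ipZl : forall a x y, ip (a *: x) y = a * ip x y;
  ip_gt0 : forall x, x != 0 -> 0 < ip x x }.

Section InnerProductTheory.
Variables (R : realType) (E : lmodType R) (f : inner_product E).
Local Notation "'[ x , y ]" := (f x y).
Local Notation "'[ x ]" := (f x x).

Lemma ipDr x y z : '[x, y + z] = '[x, y] + '[x, z].
Proof. by rewrite ipC ipDl !(ipC f x). Qed.

Lemma ipZr a x y : '[x, a *: y] = a * '[x, y].
Proof. by rewrite ipC ipZl ipC. Qed.

Lemma ipNl x y : '[- x, y] = - '[x, y].
Proof. by rewrite -scaleN1r ipZl mulN1r. Qed.

Lemma ipNr x y : '[x, - y] = - '[x, y].
Proof. by rewrite ipC ipNl ipC. Qed.

Lemma ip0l x : '[0, x] = 0.
Proof. by rewrite -(scale0r x) ipZl mul0r. Qed.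

Lemma ip0r x : '[x, 0] = 0.
Proof. by rewrite ipC ip0l. Qed.

Definition ipE := (ipDl, ipDr, ipNl, ipNr, ipZl, ipZr, ip0l, ip0r).

Lemma ip_suml (I : Type) (s : seq I) (P : pred I) (F : I -> E) y :
  '[\sum_(i <- s | P i) F i, y] = \sum_(i <- s | P i) '[F i, y].
Proof. exact: (big_morph (fun x => '[x, y]) (fun a b => ipDl f a b y) (ip0l y)). Qed.

Lemma ip_ge0 x : 0 <= '[x].
Proof. by have [->|/(ip_gt0 f)/ltW//] := eqVneq x 0; rewrite ip0l. Qed.

Lemma ip_eq0 x : '[x] = 0 -> x = 0.
Proof. by move=> x0; apply/eqP/negPn/negP => /(ip_gt0 f); rewrite x0 ltxx. Qed.

(** Testing against all vectors turns a vector identity into a polynomial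
    identity between scalars. *)
Lemma ip_ext x y : (forall w, '[x, w] = '[y, w]) -> x = y.
Proof.
move=> xy; apply/subr0_eq/ip_eq0; have := xy (x - y).
by rewrite !ipE; lra.
Qed.

Lemma ip_CauchySchwarz x y : '[x, y] ^+ 2 <= '[x] * '[y].
Proof.
have [->|y0] := eqVneq y 0; first by rewrite !ipE; nra.
have := ip_gt0 f y0; set s := '[y] => s0.
have := ip_ge0 (s *: x - '[x, y] *: y); rewrite !ipE (ipC f y x) -/s.
rewrite (_ : _ + _ = s * ('[x] * s - '[x, y] ^+ 2)); last by ring.
by rewrite pmulr_rge0 // subr_ge0.
Qed.

Lemma ip_parallelogram_le x y : '[x + y] <= 2 * '[x] + 2 * '[y].
Proof. by have := ip_ge0 (x - y); rewrite !ipE (ipC f y x); lra. Qed.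

Lemma ip_eps0 x M : (forall e, 0 < e -> '[x] <= M * e) -> x = 0.
Proof.
move=> h; apply: ip_eq0; apply/eqP; rewrite eq_le ip_ge0 andbT.
rewrite leNgt; apply/negP => x0.
have N1 : 0 < 2 * (`|M| + 1) by rewrite mulr_gt0 // ltr_wpDl.
have d0 : 0 < '[x] / (2 * (`|M| + 1)) by rewrite divr_gt0.
have := h _ d0; have := ler_wpM2r (ltW d0) (ler_norm M).
have : '[x] = 2 * (`|M| + 1) * ('[x] / (2 * (`|M| + 1))).
  by rewrite mulrCA divff ?mulr1 // gt_eqF.
by nra.
Qed.

Definition self_adjoint (T : E -> E) := forall x y, '[T x, y] = '[x, T y].
Definition symmetry (U : {linear E -> E}) :=
  self_adjoint U /\ forall x, U (U x) = x.

Lemma symmetry_isometry U x : symmetry U -> '[U x] = '[x].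
Proof. by case=> Usa UU; rewrite Usa UU. Qed.

(** * Orthonormal sequences *)

(** Only the first [n] terms are constrained, so that a sequence under
    construction can be orthonormal as far as it goes. *)
Definition orthonormal n (e : nat -> E) :=
  forall i j, (i < n)%N -> (j < n)%N -> '[e i, e j] = (i == j)%:R.

Definition fourier n (e : nat -> E) x := \sum_(i < n) '[x, e i] *: e i.

Lemma fourierE n e x j : orthonormal n e -> (j < n)%N ->
  '[fourier n e x, e j] = '[x, e j].
Proof.
move=> eo jn; rewrite /fourier ip_suml (bigD1 (Ordinal jn)) //= big1 => [|i ij].
  by rewrite ipZl eo // eqxx mulr1 addr0.
by rewrite ipZl eo // (negPf (_ : i != j :> nat)) ?mulr0.
Qed.

Lemma fourierD n e x y : fourier n e (x + y) = fourier n e x + fourier n e y.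
Proof. by rewrite -big_split; apply: eq_bigr => i _; rewrite !ipE scalerDl. Qed.

Lemma fourierZ n e a x : fourier n e (a *: x) = a *: fourier n e x.
Proof. by rewrite scaler_sumr; apply: eq_bigr => i _; rewrite !ipE scalerA. Qed.

Lemma fourier_id n e j : orthonormal n e -> (j < n)%N ->
  fourier n e (e j) = e j.
Proof.
move=> eo jn; rewrite /fourier (bigD1 (Ordinal jn)) //= big1 => [|i ij].
  by rewrite eo // eqxx scale1r addr0.
by rewrite eo // eq_sym (negPf (_ : i != j :> nat)) ?scale0r.
Qed.

Lemma ip_fourier n e x y :
  '[fourier n e x, y] = \sum_(i < n) '[x, e i] * '[y, e i].
Proof. by rewrite ip_suml; apply: eq_bigr => i _; rewrite ipZl (ipC f y). Qed.

Lemma bessel n e x : orthonormal n e -> \sum_(i < n) '[x, e i] ^+ 2 <= '[x].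
Proof.
move=> eo; have := ip_ge0 (x - fourier n e x).
have -> : \sum_(i < n) '[x, e i] ^+ 2 = '[fourier n e x, x].
  by rewrite ip_fourier.
have : '[fourier n e x] = '[fourier n e x, x].
  rewrite !ip_fourier; apply: eq_bigr => i _.
  by rewrite fourierE.
by rewrite !ipE (ipC f x (fourier _ _ _)); lra.
Qed.

Lemma normalize x : x != 0 -> exists2 s, s != 0 & '[s *: x] = 1.
Proof.
move=> /(ip_gt0 f) x0; exists (Num.sqrt '[x])^-1.
  by rewrite invr_eq0 gt_eqF // sqrtr_gt0.
by rewrite !ipE mulrA -expr2 exprVn sqr_sqrtr ?ltW // mulVf // gt_eqF.
Qed.

(** Dependent choice, where each term may depend on all the previous ones. *)
Lemma seq_choice (T : Type) (y0 : T) (Q : seq T -> T -> Prop) :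
  (forall n x, (forall i, (i < n)%N -> Q (mkseq x i) (x i)) ->
     exists y, Q (mkseq x n) y) ->
  exists x, forall n, Q (mkseq x n) (x n).
Proof.
move=> step.
pose nxt s := if pselect (exists y, Q s y) is left h then projT1 (cid h) else y0.
pose x n := nxt (iter n (fun s => rcons s (nxt s)) [::]).
have xE n : mkseq x n = iter n (fun s => rcons s (nxt s)) [::].
  by elim: n => // n IH; rewrite mkseqS IH.
exists x => n; elim/ltn_ind: n => n /step h.
have -> : x n = nxt (mkseq x n) by rewrite xE.
by rewrite /nxt; case: pselect => // h'; exact: projT2 (cid h').
Qed.

Lemma orthonormal_seq (A : set E) :
  (forall n e, orthonormal n e -> (forall i, (i < n)%N -> A (e i)) ->
     exists y, [/\ A y, '[y] = 1 & forall i, (i < n)%N -> '[y, e i] = 0]) ->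
  exists e, (forall n, orthonormal n e) /\ forall i, A (e i).
Proof.
move=> step.
pose Q s y := [/\ A y, '[y] = 1 & forall i, (i < size s)%N -> '[y, nth 0 s i] = 0].
have orthoQ n e : (forall i, (i < n)%N -> Q (mkseq e i) (e i)) -> orthonormal n e.
  move=> eQ; have lt i j : (i < n)%N -> (j < i)%N -> '[e i, e j] = 0.
    move=> /eQ [_ _]; rewrite size_mkseq => h ji.
    by have := h _ ji; rewrite nth_mkseq.
  move=> i j ni nj; case: ltngtP => [ij|ji|<-]; last by case: (eQ i ni).
    by rewrite ipC lt.
  by rewrite lt.
have [e eQ] : exists e, forall n, Q (mkseq e n) (e n).
  apply: (seq_choice 0) => n e eQ.
  have [|y [Ay y1 ye]] := step n e (orthoQ _ _ eQ); first by move=> i /eQ [].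
  exists y; split => // i; rewrite size_mkseq => ni.
  by rewrite nth_mkseq ?ye.
by exists e; split => [n|i]; [exact: orthoQ | case: (eQ i)].
Qed.

Definition subspace (A : set E) :=
  forall a x y, A x -> A y -> A (a *: x + y).

Definition finite_span (A : set E) :=
  exists n (v : 'I_n -> E), forall x, A x ->
    exists a : 'I_n -> R, x = \sum_(k < n) a k *: v k.

Lemma subspace_sum A n (a : 'I_n -> R) (v : 'I_n -> E) : subspace A -> A 0 ->
  (forall i, A (v i)) -> A (\sum_(i < n) a i *: v i).
Proof.
move=> As A0 Av; elim/big_ind: _ => // [x y Ax Ay|i _].
  by have := As 1 _ _ Ax Ay; rewrite scale1r.
by have := As (a i) _ _ (Av i) A0; rewrite addr0.
Qed.

Lemma subspaceB A x y : subspace A -> A x -> A y -> A (x - y).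
Proof. by move=> As Ax Ay; have := As (-1) _ _ Ay Ax; rewrite scaleN1r addrC. Qed.

(** Gram-Schmidt: a vector of [A] outside the span of the terms already chosen
    has a nonzero component orthogonal to them. *)
Lemma infinite_span_orthonormal (A : set E) : subspace A -> A 0 ->
  ~ finite_span A -> exists e, (forall n, orthonormal n e) /\ forall i, A (e i).
Proof.
move=> As A0 Ainf; apply: orthonormal_seq => n e eo Ae.
have [x Ax xe] : exists2 x, A x & x - fourier n e x != 0.
  apply: contrapT => h; apply: Ainf; exists n, (fun i => e i) => x Ax.
  exists (fun i => '[x, e i]); apply/eqP; rewrite -subr_eq0.
  by apply/negPn/negP => xe; apply: h; exists x.
have [s s0 s1] := normalize xe; exists (s *: (x - fourier n e x)); split => //.
  have -> : s *: (x - fourier n e x) = s *: (x - fourier n e x) + 0 by rewrite addr0.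
  apply: (As) => //; apply: subspaceB => //.
  by apply: subspace_sum => // i; apply: Ae.
by move=> i ni; rewrite !ipE fourierE // subrr mulr0.
Qed.

(** * Compactness along an ultrafilter *)

(** An ultrafilter [U] finer than the Frechet filter replaces the extraction of
    subsequences: for a compact operator, the images of any bounded sequence
    converge along the same [U], so limits of several sequences can be combined. *)
Section Compact.
Variables (U : set_system nat) (UF : ProperFilter U).
Hypothesis Uoo : \oo `<=` U.

Definition compact_along (T : E -> E) := forall x M, (forall n, '[x n] <= M) ->
  exists l, forall e, 0 < e -> U [set n | '[T (x n) - l] < e].

Lemma compact_along_freq T x M : compact_along T -> (forall n, '[x n] <= M) ->
  exists l, forall e N, 0 < e -> exists2 n, (N <= n)%N & '[T (x n) - l] < e.
Proof.
move=> Tc /Tc [l lP]; exists l => e N e0.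
have /Uoo UN : \oo [set n | (N <= n)%N] by exists N.
by have [n [? ?]] := @filter_ex _ U _ _ (filterI UN (lP _ e0)); exists n.
Qed.

Lemma compact_along_close T x M d : compact_along T -> (forall n, '[x n] <= M) ->
  0 < d -> exists i j : nat, i != j /\ '[T (x i) - T (x j)] < d.
Proof.
move=> Tc xM d0; have [l lP] := compact_along_freq Tc xM.
have d4 : 0 < d / 4 by lra.
have [i _ il] := lP _ 0%N d4; have [j ij jl] := lP _ i.+1 d4.
exists i, j; split; first by rewrite neq_ltn ij.
have := ip_parallelogram_le (T (x i) - l) (l - T (x j)).
have -> : T (x i) - l + (l - T (x j)) = T (x i) - T (x j).
  by apply: ip_ext => w; rewrite !ipE; ring.
have -> : '[l - T (x j)] = '[T (x j) - l] by rewrite -(opprB (T _)) !ipE; ring.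
lra.
Qed.

(** Otherwise [A] contains an orthonormal sequence; its terms are at distance
    [sqrt 2], and coercivity keeps their images under [T] apart. *)
Lemma coercive_finite_span (T : {linear E -> E}) (A : set E) d :
  compact_along T -> subspace A -> A 0 -> 0 < d ->
  (forall x, A x -> d * '[x] <= '[T x, x]) -> finite_span A.
Proof.
move=> Tc As A0 d0 dT; apply: contrapT => /(infinite_span_orthonormal As A0).
move=> [e [eo Ae]]; have e1 n : '[e n] <= 1 by rewrite (eo n.+1) // eqxx.
have [i [j [ij]]] := compact_along_close Tc e1 (ltac:(nra) : 0 < 2 * d ^+ 2).
rewrite -linearB => Tij; have := dT _ (subspaceB As (Ae i) (Ae j)).
have := ip_CauchySchwarz (T (e i - e j)) (e i - e j).
have -> : '[e i - e j] = 2.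
  rewrite !ipE !(eo (maxn i j).+1) ?ltnS ?leq_maxl ?leq_maxr // !eqxx.
  by rewrite [j == i]eq_sym (negPf ij) /=; lra.
nra.
Qed.

End Compact.
End InnerProductTheory.

(** * Eigenvectors of compact selfadjoint operators *)

Section Operators.
Variables (R : realType) (E : lmodType R) (f : inner_product E).
Local Notation "'[ x , y ]" := (f x y).
Local Notation "'[ x ]" := (f x x).

(** [n + 1] vectors in the span of [n] vectors: a nonzero row in the left kernel
    of the matrix of coordinates gives the relation. *)
Lemma finite_span_dependent (A : set E) (y : nat -> E) :
  finite_span A -> (forall i, A (y i)) ->
  exists n (a : 'I_n -> R), (exists i, a i != 0) /\ \sum_(i < n) a i *: y i = 0.
Proof.
move=> [n [v vA]] Ay; have [c cE] := choice (fun i : nat => vA _ (Ay i)).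
pose C := \matrix_(i < n.+1, k < n) c i k.
have : nz_row (kermx C) != 0.
  rewrite nz_row_eq0 -mxrank_eq0 mxrank_ker -lt0n subn_gt0.
  by rewrite ltnS rank_leq_col.
move=> /rV0Pn[i ui]; exists n.+1, (fun i => nz_row (kermx C) 0 i).
split; first by exists i.
have /sub_kermxP uC := nz_row_sub (kermx C).
under eq_bigr => j _ do rewrite cE scaler_sumr.
rewrite exchange_big big1 // => k _.
under eq_bigr => j _ do rewrite scalerA.
rewrite -scaler_suml; have /rowP/(_ k) := uC; rewrite !mxE => uCk.
rewrite (_ : \sum_(_ < _) _ = 0) ?scale0r // -[RHS]uCk.
by apply: eq_bigr => j _; rewrite [C _ _]mxE.
Qed.

(** The form of [T] is nonnegative at [x + s *: T x] for every real [s], and its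
    term linear in [s] is [2 * s * '[T x]]. *)
Lemma nonneg_kernel (T : {linear E -> E}) x : self_adjoint f T ->
  (forall x, 0 <= '[T x, x]) -> '[T x, x] = 0 -> T x = 0.
Proof.
move=> Tsa T0 Tx0; apply: (ip_eq0 (f := f)); set q := '[T x]; set d := '[T (T x), T x].
have q0 : 0 <= q by exact: ip_ge0.
have d0 : 0 <= d by exact: T0.
(* Minimizing [2 s q + s^2 d] would suggest [- q / d]; the shift by 1 also covers
   [d = 0]. *)
pose s := - q / (1 + d).
have sd : s * (1 + d) = - q by rewrite /s mulfVK // gt_eqF //; lra.
have := T0 (x + s *: T x); rewrite linearD linearZ !ipE /= Tx0.
have -> : '[T (T x), x] = q by rewrite Tsa.
rewrite -/q -/d => h.
have : 0 <= (1 + d) ^+ 2 * (2 * s * q + s ^+ 2 * d) by rewrite mulr_ge0 ?sqr_ge0 //; lra.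
have -> : (1 + d) ^+ 2 * (2 * s * q + s ^+ 2 * d) =
    2 * (s * (1 + d)) * (1 + d) * q + (s * (1 + d)) ^+ 2 * d by ring.
rewrite sd => h'; have : q ^+ 2 * (d + 2) <= 0 by nra.
by rewrite pmulr_lle0 => [|]; nra.
Qed.

(** Since [(T + r) (T - r) x = 0], either [x] is an eigenvector for [r] or
    [T x - r x] is one for [- r]. *)
Lemma sqrt_eigenvector (T : {linear E -> E}) (Z : set E) x r :
  subspace Z -> (forall z, Z z -> Z (T z)) -> Z x -> x != 0 ->
  T (T x) = r ^+ 2 *: x ->
  exists y s, [/\ Z y, y != 0, s ^+ 2 = r ^+ 2 & T y = s *: y].
Proof.
move=> Zs TZ Zx x0 TTx; have [Tx|y0] := eqVneq (T x) (r *: x).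
  by exists x, r.
exists (T x - r *: x), (- r); split; last first.
- rewrite linearB linearZZ TTx; apply: (ip_ext (f := f)) => v;
  by rewrite !ipE; ring.
- by rewrite sqrrN.
- by rewrite subr_eq0.
- by rewrite addrC -scaleNr; apply: Zs => //; exact: TZ.
Qed.

Section Spectral.
Variables (U : set_system nat) (UF : ProperFilter U).
Hypothesis Uoo : \oo `<=` U.

(** If [x n] in the unit ball of [Z] maximizes ['[T x]], with supremum [m], then
    [T (T (x n)) - m *: x n] tends to 0; a limit point [l] of [T (x n)], which
    exists by compactness, satisfies [T (T l) = m *: l], and is nonzero as
    ['[l] = m]. Allowing an invariant closed subspace [Z] lets one look for
    eigenvectors orthogonal to given ones. *)
Lemma compact_square_eigenvector (T : {linear E -> E}) (Z : set E) M z0 :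
  self_adjoint f T -> (forall x, '[T x] <= M * '[x]) -> compact_along f U T ->
  subspace Z -> (forall z, Z z -> Z (T z)) ->
  (forall l, (forall e, 0 < e -> exists2 z, Z z & '[z - l] < e) -> Z l) ->
  Z z0 -> T z0 != 0 ->
  exists l r, [/\ Z l, l != 0, 0 < r & T (T l) = r ^+ 2 *: l].
Proof.
move=> Tsa TM Tc Zs TZ Zc Zz0 Tz0.
have Z0 : Z 0 by have := Zs (-1) _ _ Zz0 Zz0; rewrite scaleN1r addNr.
have ZZ a z : Z z -> Z (a *: z) by move=> Zz; have := Zs a _ _ Zz Z0; rewrite addr0.
pose S := [set '[T z] | z in [set z | Z z /\ '[z] <= 1]].
have M0 : 0 <= M.
  have := TM z0; have := ip_gt0 f Tz0; have := ip_ge0 f z0; nra.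
have Ssup : has_sup S.
  split; first by exists '[T 0]; exists 0 => //; rewrite /= ip0l ler01.
  exists M => _ [z [_ z1] <-]; have := TM z; have := ip_ge0 f z; nra.
pose m := sup S.
have Tm z : Z z -> '[T z] <= m * '[z].
  have [->|z1] := eqVneq z 0; first by rewrite linear0 !ip0l mulr0.
  move=> Zz; have [s s0 sz] := normalize f z1.
  have : '[T (s *: z)] <= m.
    apply: sup_upper_bound => //; exists (s *: z) => //.
    by rewrite /= sz; split => //; exact: ZZ.
  move: sz; rewrite linearZ !ipE => sz sT.
  have s2 : 0 < s ^+ 2 by rewrite exprn_even_gt0.
  rewrite -(ler_pM2l s2); have -> : s ^+ 2 * (m * '[z]) = m * (s * (s * '[z])) by ring.
  by rewrite sz mulr1 expr2 -mulrA.
have m0 : 0 < m.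
  have := Tm _ Zz0; have := ip_gt0 f Tz0; have := ip_ge0 f z0; nra.
have near_sup n : exists y, [/\ Z y, '[y] <= 1 & m - n.+1%:R^-1 < '[T y]].
  have n0 : (0 : R) < n.+1%:R^-1 by rewrite invr_gt0.
  by have [_ [z [Zz z1] <-] zm] := sup_adherent n0 Ssup; exists z.
have [x xP] := choice near_sup.
have x1 n : '[x n] <= 1 by case: (xP n).
have [l lP] := compact_along_freq UF Uoo Tc x1.
have near e : 0 < e -> exists n, '[T (x n) - l] < e /\ m - '[T (x n)] < e.
  move=> e0; have [n nN ln] := lP e (Num.truncn e^-1) e0; exists n; split=> //.
  have [_ _ h] := xP n; suff : n.+1%:R^-1 <= e by move: h; set d := _^-1; lra.
  rewrite -[e]invrK lef_pV2 ?posrE ?invr_gt0 //.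
  by apply/ltW/(lt_le_trans (truncnS_gt _)); rewrite ler_nat ltnS.
exists l, (Num.sqrt m); split.
- apply: Zc => e /near [n [ln _]]; exists (T (x n)) => //.
  by apply: TZ; case: (xP n).
- apply/eqP => l0; have [n [+ +]] := near (m / 2) ltac:(lra).
  by rewrite l0 subr0; lra.
- by rewrite sqrtr_gt0.
rewrite sqr_sqrtr ?ltW //; apply: subr0_eq.
apply: (@ip_eps0 _ _ f _ (4 * M ^+ 2 + 4 * m ^+ 2 + 2 * M * m)) => e /near [n [ln mn]].
have [Zx xn1 _] := xP n.
pose w := T (x n) - l; pose u := T (T (x n)) - m *: x n.
have -> : T (T l) - m *: l = (m *: w - T (T w)) + T u.
  rewrite /w /u !linearB !linearZZ.
  by apply: (ip_ext (f := f)) => v; rewrite !ipE; ring.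
have u_le : '[u] <= m * e.
  have TTx : '[T (T (x n)), x n] = '[T (x n)] by rewrite Tsa.
  have := Tm _ (TZ _ Zx); rewrite /u !ipE (ipC f (x n)) TTx.
  by have := ip_ge0 f (T (x n)); nra.
have w_ge0 := ip_ge0 f w.
have Tw_le : '[T w] <= M * e by have := TM w; rewrite /w in w_ge0 *; nra.
have TTw_le : '[T (T w)] <= M * (M * e) by have := TM (T w); nra.
have Tu_le : '[T u] <= M * (m * e) by have := TM u; nra.
have mw_le : '[m *: w] <= m * (m * e).
  by rewrite ipZl ipZr; have := ler_wpM2l (ltW m0) (ltW ln); nra.
have := ip_parallelogram_le f (m *: w - T (T w)) (T u).
have := ip_parallelogram_le f (m *: w) (- T (T w)).
have -> : '[- T (T w)] = '[T (T w)] by rewrite ipNl ipNr opprK.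
nra.
Qed.

End Spectral.
End Operators.

(** * Nonnegative compact perturbations of a multiple of a symmetry *)

Lemma nonzero_lower_bound (R : realType) (T : eqType) (s : seq T) (h : T -> R) :
  exists2 d, 0 < d & forall c, c \in s -> h c != 0 -> d <= `|h c|.
Proof.
elim: s => [|c s [d d0 sd]]; first by exists 1.
have [hc|hc] := eqVneq (h c) 0.
  by exists d => // c'; rewrite inE => /orP[/eqP->|/sd//]; rewrite hc eqxx.
exists (Num.min d `|h c|); first by rewrite lt_min d0 normr_gt0.
move=> c'; rewrite inE ge_min => /orP[/eqP->|/sd c'd /c'd->//].
by rewrite lexx orbT.
Qed.

Section Perturbation.
Variables (R : realType) (E : lmodType R) (f : inner_product E).
Local Notation "'[ x , y ]" := (f x y).
Local Notation "'[ x ]" := (f x x).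
Variables (U : set_system nat) (UF : ProperFilter U).
Hypothesis Uoo : \oo `<=` U.
Variables (K V : {linear E -> E}) (g M : R).
Hypotheses (Ksa : self_adjoint f K) (K_ge0 : forall x, 0 <= '[K x, x]).
Hypotheses (Kc : compact_along f U K) (M_ge0 : 0 <= M) (KM : forall x, '[K x] <= M * '[x]).
Hypotheses (Vs : symmetry f V) (g_ge0 : 0 <= g).

Variable B : {linear E -> E}.
Hypothesis perturbedE : forall x, B x = K x + g *: V x.

Lemma perturbed_sa : self_adjoint f B.
Proof. by move=> x y; rewrite !perturbedE !ipE Ksa; case: Vs => ->. Qed.

Lemma perturbed_bounded x : '[B x] <= (2 * M + 2 * g ^+ 2) * '[x].
Proof.
have := ip_parallelogram_le f (K x) (g *: V x); rewrite -perturbedE.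
by rewrite ipZl ipZr (symmetry_isometry _ Vs); have := KM x; nra.
Qed.

Definition eigenvalue_of (T : E -> E) : set R :=
  [set b | exists2 x, x != 0 & T x = b *: x].

Lemma eigenvalue_ge b : eigenvalue_of B b -> - g <= b.
Proof.
move=> [x /(ip_gt0 f) x0 Bx].
have : '[B x, x] = b * '[x] by rewrite Bx ipZl.
have := mulr_ge0 g_ge0 (ip_ge0 f (x + V x)).
rewrite perturbedE !ipE (symmetry_isometry _ Vs) (ipC f x (V x)) => h Kx.
rewrite -subr_ge0 -(pmulr_lge0 _ x0); have := K_ge0 x; lra.
Qed.

(** The operator [B^2 - g^2], compact because [(g V)^2 = g^2]; its eigenvalues
    [b^2 - g^2] measure how far those of [B] are from [g] and [- g]. *)
Definition perturbed_sqr : {linear E -> E} := (B \o B) \- (g ^+ 2 \*: idfun).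
Arguments perturbed_sqr : simpl never.
Local Notation F := perturbed_sqr.

Lemma perturbed_sqrE x : F x = B (B x) - g ^+ 2 *: x. Proof. by []. Qed.

Lemma perturbed_sqr_factor x : F x = K (B x) + g *: V (K x).
Proof.
have VB : V (B x) = V (K x) + g *: x.
  by case: Vs => _ VV; rewrite perturbedE linearD linearZZ VV.
rewrite perturbed_sqrE (perturbedE (B x)) VB.
by apply: (ip_ext (f := f)) => v; rewrite !ipE; ring.
Qed.

Lemma perturbed_sqr_compact : compact_along f U F.
Proof.
move=> x N xN.
have [l lP] := Kc xN.
have BN n : '[B (x n)] <= (2 * M + 2 * g ^+ 2) * N.
  apply: le_trans (perturbed_bounded _) _; apply: ler_wpM2l => //.
  by rewrite addr_ge0 // mulr_ge0 // sqr_ge0.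
have [l' l'P] := Kc BN.
exists (l' + g *: V l) => e e0.
have g1 : 0 < 4 * (g ^+ 2 + 1) by nra.
have e1 : 0 < e / 4 by lra.
have e2 : 0 < e / (4 * (g ^+ 2 + 1)) by exact: divr_gt0.
apply: filterS (filterI (lP _ e2) (l'P _ e1)) => n [h h']; rewrite /mkset in h h' *.
rewrite perturbed_sqr_factor.
have := ip_parallelogram_le f (K (B (x n)) - l') (g *: V (K (x n) - l)).
rewrite linearB /=.
have -> : K (B (x n)) - l' + g *: (V (K (x n)) - V l) =
          K (B (x n)) + g *: V (K (x n)) - (l' + g *: V l).
  by apply: (ip_ext (f := f)) => v; rewrite !ipE; ring.
rewrite -linearB ipZl ipZr (symmetry_isometry _ Vs).
move: h; rewrite ltr_pdivlMr // => h.
have := ip_ge0 f (K (x n) - l); nra.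
Qed.

Lemma eigen_seq (A : set R) : infinite_set A -> A `<=` eigenvalue_of B ->
  exists b x, [/\ forall n, orthonormal f n x, forall i, A (b i) &
                  forall i, B (x i) = b i *: x i].
Proof.
move=> /infiniteP/pcard_leP/unsquash b Aeig.
have Ab i : A (b i) by exact: funS.
have unit_eig i : exists y, '[y] = 1 /\ B y = b i *: y.
  have [y y0 By] := Aeig _ (Ab i); have [s s0 s1] := normalize f y0.
  by exists (s *: y); rewrite linearZZ By !scalerA mulrC.
have [x xP] := choice unit_eig; exists b, x; split=> // [n i j _ _|i]; last by case: (xP i).
case: (xP i) (xP j) => [xi Bxi] [xj Bxj]; have [<-//|ij] := eqVneq i j.
have /eqP := perturbed_sa (x i) (x j); rewrite Bxi Bxj ipZl ipZr.
rewrite -subr_eq0 -mulrBl mulf_eq0 subr_eq0 => /orP[/eqP bij|/eqP//].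
by case/eqP: ij; apply: (@inj _ _ _ b); rewrite ?inE.
Qed.

(** The compact operator [F] stretches [x i] by [b i ^+ 2 - g ^+ 2], and the
    images stay orthogonal. *)
Lemma no_far_eigen_seq b x e : (forall n, orthonormal f n x) ->
  (forall i, B (x i) = b i *: x i) -> 0 < e ->
  ~ forall i, e <= `|b i ^+ 2 - g ^+ 2|.
Proof.
move=> xo Bx e0 far; have x1 n : '[x n] <= 1 by rewrite (xo n.+1) // eqxx.
have Fx i : F (x i) = (b i ^+ 2 - g ^+ 2) *: x i.
  by rewrite perturbed_sqrE Bx linearZZ Bx scalerA scalerBl expr2.
have [i [j [ij]]] := compact_along_close UF Uoo perturbed_sqr_compact x1 (exprn_gt0 2 e0).
rewrite !Fx !ipE !(xo (maxn i j).+1) ?ltnS ?leq_maxl ?leq_maxr // !eqxx.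
rewrite [j == i]eq_sym (negPf ij) /=.
have := far i; have := far j; have := real_normK (num_real (b i ^+ 2 - g ^+ 2)).
have := real_normK (num_real (b j ^+ 2 - g ^+ 2)); nra.
Qed.

Lemma far_eigenvalues_finite e : 0 < e ->
  finite_set (eigenvalue_of B `&` [set b | e <= `|b ^+ 2 - g ^+ 2|]).
Proof.
move=> e0; apply: contrapT => /eigen_seq [|b [x [xo bP Bx]]]; first exact: subIsetl.
by apply: (no_far_eigen_seq xo Bx e0) => i; case: (bP i).
Qed.

(** The difference of the two sides is ['[K (x + V x), x + V x]]. *)
Lemma reflected_coercive x : - 4 * '[K x, V x] <= '[K (x - V x), x - V x].
Proof.
have := K_ge0 (x + V x); rewrite linearB linearD !ipE /=.
have -> : '[K (V x), x] = '[K x, V x] by rewrite Ksa ipC.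
lra.
Qed.

Lemma ip_reflected x : '[x - V x] = 2 * '[x] - 2 * '[V x, x].
Proof. by rewrite !ipE (symmetry_isometry _ Vs) (ipC f x (V x)); ring. Qed.

(** The vector [y = x - V x] is twice the component of [x] where [V = -1]. With
    [a i] and [v i] the coordinates of [x] and [V x], [reflected_coercive]
    bounds ['[K y, y]] below by [2 g '[y] - 4 \sum (b i - g) (a i) (v i)];
    as [0 <= b i <= g], the sum costs at most
    [g \sum (a i - v i)^2], which is at most [g '[y]] by Bessel. *)
Lemma gap_coercive n (b : nat -> R) (e : nat -> E) x : orthonormal f n e ->
  (forall i, B (e i) = b i *: e i) -> (forall i, 0 <= b i <= g) ->
  x = fourier f n e x -> g * '[x - V x] <= '[K (x - V x), x - V x].
Proof.
move=> eo Be bg xE; apply: le_trans (reflected_coercive x).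
have -> : '[K x, V x] = '[B x, V x] - g * '[x].
  by rewrite perturbedE ipDl ipZl (symmetry_isometry _ Vs) addrK.
have BxE : '[B x, V x] = \sum_(i < n) b i * ('[x, e i] * '[V x, e i]).
  rewrite {1}xE /fourier linear_sum ip_suml; apply: eq_bigr => i _.
  by rewrite linearZZ Be !ipE (ipC f (e i)); ring.
have VxE : '[V x, x] = \sum_(i < n) '[x, e i] * '[V x, e i].
  by rewrite ipC -ip_fourier -xE.
have := bessel (x - V x) eo.
suff le : 4 * '[B x, V x] - 4 * g * '[V x, x] <= g * \sum_(i < n) '[x - V x, e i] ^+ 2.
  by move=> /(ler_wpM2l g_ge0); have := ip_reflected x; nra.
rewrite BxE VxE !mulr_sumr -sumrB; apply: ler_sum => i _.
have /andP[b0 b1] := bg i; rewrite !ipE.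
move: ('[x, e i]) ('[V x, e i]) => u v.
have : 0 <= (g - b i) * (u + v) ^+ 2 by rewrite mulr_ge0 ?sqr_ge0 ?subr_ge0.
have : 0 <= b i * (u - v) ^+ 2 by rewrite mulr_ge0 ?sqr_ge0.
nra.
Qed.

(** Suppose there were an orthonormal sequence [e] of eigenvectors. On the
    vectors [x - V x], for [x] in the span of [e], the compact [K] is coercive,
    so these vectors span a finite dimensional space, and [V x = x] for some
    nonzero [x] in the span. For it, ['[B x, x] = '[K x, x] + g '[x] >= g '[x]],
    although all the eigenvalues involved are less than [g]. *)
Lemma gap_eigenvalues_finite :
  finite_set (eigenvalue_of B `&` [set b | 0 <= b < g]).
Proof.
apply: contrapT => /eigen_seq [|b [e [eo bP Be]]]; first exact: subIsetl.
have bg i : 0 <= b i < g by case: (bP i).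
have g0 : 0 < g by have /andP[] := bg 0%N; exact: le_lt_trans.
(* The linear span of the sequence: the expansions in [e] that terminate. *)
pose A := [set x | exists n, forall m, (n <= m)%N -> fourier f m e x = x].
have As : subspace A.
  move=> a x y [n nx] [n' ny]; exists (maxn n n') => m.
  by rewrite geq_max => /andP[/nx mx /ny my]; rewrite fourierD fourierZ mx my.
have A0 : A 0 by exists 0%N => m _; rewrite -(scale0r 0) fourierZ !scale0r.
have Ae i : A (e i) by exists i.+1 => m im; rewrite fourier_id.
have E1 : finite_span [set x - V x | x in A].
  apply: (coercive_finite_span UF Uoo Kc _ _ g0).
  - move=> c _ _ [x Ax <-] [y Ay <-]; exists (c *: x + y); first exact: As.
    rewrite linearD linearZZ.
    by apply: (ip_ext (f := f)) => w; rewrite !ipE; ring.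
  - by exists 0 => //; rewrite linear0 subr0.
  move=> _ [x [n nx] <-]; apply: (gap_coercive (eo n) Be) => [i|].
    by have /andP[-> /ltW] := bg i.
  by rewrite nx.
have [i|n [a [[i ai] ae0]]] := finite_span_dependent (y := fun i => e i - V (e i)) E1.
  by exists (e i).
pose x := \sum_(i < n) a i *: e i.
have Vx : V x = x.
  apply/esym/subr0_eq; rewrite -[RHS]ae0 linear_sum -sumrB.
  by apply: eq_bigr => j _; rewrite linearZZ scalerBr.
have ex (j : 'I_n) : '[e j, x] = a j.
  rewrite ipC ip_suml (bigD1 j) //= big1 => [|k kj].
    by rewrite ipZl (eo n) // eqxx mulr1 addr0.
  by rewrite ipZl (eo n) // (negPf (_ : k != j :> nat)) ?mulr0.
have : '[B x, x] = \sum_(i < n) b i * a i ^+ 2.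
  rewrite {1}/x linear_sum ip_suml; apply: eq_bigr => j _.
  by rewrite linearZZ Be !ipZl ex; ring.
have : '[x] = \sum_(i < n) a i ^+ 2.
  by rewrite {1}/x ip_suml; apply: eq_bigr => j _; rewrite ipZl ex expr2.
have := K_ge0 x; rewrite perturbedE Vx ipDl ipZl => Kx xx Bx.
have : \sum_(i < n) (g - b i) * a i ^+ 2 <= 0.
  under eq_bigr do rewrite mulrBl.
  by rewrite sumrB -mulr_sumr -Bx -xx; lra.
rewrite leNgt (bigD1 i) //= ltr_wpDr // ?sumr_ge0 // => [j _|].
  by rewrite mulr_ge0 ?sqr_ge0 // subr_ge0; have /andP[_ /ltW] := bg j.
by rewrite mulr_gt0 ?exprn_even_gt0 // subr_gt0; have /andP[] := bg i.
Qed.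

(** If [g = 0] then [K^2 = 0] on the orthogonal complement [Z] of finitely many
    vectors, so [K = 0] there. Let [g > 0] and [B^2 = g^2] on [Z]. Then [Z]
    splits into the parts where [B = - g] and [B = g]. On the first one
    ['[K x, x] = - g '[x + V x] / 2 <= 0], so [K = 0]. On the second one
    [K x = g *: (x - V x)], and [K] is coercive on these vectors by
    [reflected_coercive], so they span a finite dimensional space. *)
Lemma perturbed_sqr_eq0_finite_span n e : orthonormal f n e ->
  (forall z, (forall i, (i < n)%N -> '[z, e i] = 0) ->
     (forall i, (i < n)%N -> '[B z, e i] = 0) /\ F z = 0) ->
  finite_span (range K).
Proof.
move=> eo; pose Z := [set z | forall i, (i < n)%N -> '[z, e i] = 0].
move=> ZP; have ZB z : Z z -> Z (B z) by move=> /ZP[].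
have BB z : Z z -> B (B z) = g ^+ 2 *: z.
  by move=> /ZP[_ /eqP]; rewrite perturbed_sqrE subr_eq0 => /eqP.
have ZZ : subspace Z by move=> a x y Zx Zy i ni; rewrite ipDl ipZl Zx // Zy // mulr0 addr0.
have [m [v vP]] : exists m (v : 'I_m -> E), forall z, Z z ->
    exists a : 'I_m -> R, K z = \sum_(k < m) a k *: v k.
  have [g_eq0|g_neq0] := eqVneq g 0.
    exists 0%N, (fun=> 0) => z /BB Bz; exists (fun=> 0); rewrite big_ord0.
    have BK x : B x = K x by rewrite perturbedE g_eq0 scale0r addr0.
    move: Bz; rewrite !BK g_eq0 expr0n scale0r => KKz.
    by apply: (ip_eq0 (f := f)); rewrite -Ksa KKz ip0l.
  have g0 : 0 < g by rewrite lt_neqAle eq_sym g_neq0.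
  pose A := [set K z | z in [set z | Z z /\ B z = g *: z]].
  have [m [v vA]] : finite_span A.
    apply: (coercive_finite_span UF Uoo Kc (d := 2 * g)); last first.
    - move=> _ [z [Zz Bz] <-].
      have Kz : K z = g *: (z - V z).
        have -> : K z = B z - g *: V z by rewrite perturbedE addrK.
        by rewrite Bz scalerBr.
      rewrite Kz linearZZ !ipZl !ipZr.
      have KVz : '[K z, V z] = g * '[V z, z] - g * '[z].
        by rewrite Kz !ipE (symmetry_isometry _ Vs) (ipC f z); ring.
      have := reflected_coercive z; rewrite KVz ip_reflected => h.
      have := ler_wpM2l (mulr_ge0 g_ge0 g_ge0) h; nra.
    - by lra.
    - exists 0; rewrite ?linear0 //; split; last by rewrite linear0 scaler0.
      by move=> i _; rewrite ip0l.
    move=> a _ _ [x [Zx Bx] <-] [y [Zy By] <-]; exists (a *: x + y).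
      split; first exact: ZZ.
      by rewrite linearD linearZZ Bx By scalerDr !scalerA mulrC.
    by rewrite linearD linearZZ.
  exists m, v => z Zz; have Bz := BB _ Zz.
  pose p := (2 * g)^-1 *: (B z + g *: z); pose q := (2 * g)^-1 *: (g *: z - B z).
  have zE : z = p + q.
    by apply: (ip_ext (f := f)) => w; rewrite !ipE; field.
  have Kq : K q = 0.
    apply: (nonneg_kernel Ksa K_ge0); apply/le_anti; rewrite K_ge0 andbT.
    have Bq : B q = - g *: q.
      rewrite linearZZ linearB linearZZ Bz.
      by apply: (ip_ext (f := f)) => w; rewrite !ipE; field.
    move: (q) Bq => u Bu.
    have -> : K u = - g *: u - g *: V u by rewrite -Bu perturbedE addrK.
    have := mulr_ge0 g_ge0 (ip_ge0 f (u + V u)).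
    by rewrite !ipE (symmetry_isometry _ Vs) (ipC f u (V u)); lra.
  have Zp : Z p.
    by move=> i ni; rewrite /p ipZl ipDl ipZl ZB // Zz // mulr0 addr0 mulr0.
  have [|a Kp] := vA (K p).
    exists p => //; split=> //.
    rewrite linearZZ [B (_ + _)]linearD [B (g *: z)]linearZZ Bz.
    by apply: (ip_ext (f := f)) => w; rewrite !ipE; field.
  by exists a; rewrite zE linearD Kq addr0.
exists (n + m)%N, (fun i => match fintype.split i with inl j => K (e j) | inr k => v k end).
move=> _ [x _ <-].
have [|a aP] := vP (x - fourier f n e x).
  by move=> i ni; rewrite ipDl ipNl fourierE // subrr.
exists (fun i => match fintype.split i with inl j => '[x, e j] | inr k => a k end).
rewrite big_split_ord /=.
have -> : K x = K (fourier f n e x) + K (x - fourier f n e x).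
  by rewrite -linearD addrC subrK.
rewrite aP; congr (_ + _).
  rewrite linear_sum; apply: eq_bigr => j _.
  by rewrite (unsplitK (inl j)) linearZZ.
by apply: eq_bigr => j _; rewrite (unsplitK (inr j)).
Qed.

(** As long as finitely many orthonormal eigenvectors have been found, [F] cannot
    vanish on their orthogonal complement, which provides a further one with
    [b ^+ 2 != g ^+ 2]. Finitely many eigenvalues would keep [b ^+ 2 - g ^+ 2]
    away from 0 along the resulting sequence. *)
Lemma eigenvalues_infinite : ~ finite_span (range K) ->
  infinite_set (eigenvalue_of B `&` [set b | b ^+ 2 != g ^+ 2]).
Proof.
move=> Kinf Sfin; pose A := [set x | exists2 b, b ^+ 2 != g ^+ 2 & B x = b *: x].
have [|e [eo Ae]] := @orthonormal_seq _ _ f A.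
  move=> n e eo Ae; pose Z := [set z | forall i, (i < n)%N -> '[z, e i] = 0].
  have ZB z : Z z -> Z (B z).
    move=> Zz i ni; have [b _ Be] := Ae _ ni.
    by rewrite perturbed_sa Be ipZr Zz // mulr0.
  have ZZ : subspace Z by move=> a x y Zx Zy i ni; rewrite ipDl ipZl Zx // Zy // mulr0 addr0.
  have ZF z : Z z -> Z (F z).
    move=> Zz; rewrite perturbed_sqrE addrC -scaleNr; apply: ZZ => //.
    exact: (ZB _ (ZB _ Zz)).
  have [z Zz Fz] : exists2 z, Z z & F z != 0.
    apply: contrapT => h; apply: Kinf; apply: (perturbed_sqr_eq0_finite_span eo).
    move=> z Zz; split; first exact: ZB.
    by apply/eqP/negPn/negP => Fz; apply: h; exists z.
  have FM x : '[F x] <= 2 * ((2 * M + 2 * g ^+ 2) ^+ 2 + g ^+ 4) * '[x].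
    have := ip_parallelogram_le f (B (B x)) (- (g ^+ 2 *: x)); rewrite -perturbed_sqrE.
    have M0 : 0 <= 2 * M + 2 * g ^+ 2 by rewrite addr_ge0 // mulr_ge0 // sqr_ge0.
    have := ler_wpM2l M0 (perturbed_bounded x); have := perturbed_bounded (B x).
    rewrite !ipNl !ipNr opprK ipZl ipZr; nra.
  have Fsa : self_adjoint f F.
    by move=> x y; rewrite !perturbed_sqrE !ipE !perturbed_sa.
  have Zclosed l : (forall d, 0 < d -> exists2 z, Z z & '[z - l] < d) -> Z l.
    move=> Zl i ni; apply/eqP; rewrite -sqrf_eq0 eq_le sqr_ge0 andbT leNgt.
    apply/negP => /Zl [y Zy]; have := ip_CauchySchwarz f (y - l) (e i).
    rewrite [X in X ^+ 2]ipDl ipNl Zy // (eo i i) // eqxx mulr1 sub0r sqrrN.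
    by rewrite leNgt => /negP.
  have [l [r [Zl l0 r0 FFl]]] := compact_square_eigenvector UF Uoo Fsa FM
    perturbed_sqr_compact ZZ ZF Zclosed Zz Fz.
  have [y [s [Zy y0 sr Fy]]] := sqrt_eigenvector f ZZ ZF Zl l0 FFl.
  have BBy : B (B y) = (s + g ^+ 2) *: y.
    by rewrite scalerDl -Fy perturbed_sqrE subrK.
  have sg : 0 <= s + g ^+ 2.
    have : '[B y] = (s + g ^+ 2) * '[y] by rewrite -perturbed_sa BBy ipZl.
    by rewrite -(pmulr_lge0 _ (ip_gt0 f y0)) => <-; exact: ip_ge0.
  rewrite -(sqr_sqrtr sg) in BBy.
  have [x [b [Zx x0 bE Bx]]] := sqrt_eigenvector f ZZ ZB Zy y0 BBy.
  have [t t0 t1] := normalize f x0; exists (t *: x); split => //; last first.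
    by move=> i ni; rewrite ipZl Zx // mulr0.
  exists b; last by rewrite linearZZ Bx !scalerA mulrC.
  rewrite bE sqr_sqrtr // -subr_eq0 addrK.
  by rewrite -sqrf_eq0 sr sqrf_eq0 gt_eqF.
have eig i : exists b, b ^+ 2 != g ^+ 2 /\ B (e i) = b *: e i.
  by have [b ? ?] := Ae i; exists b.
have [b bP] := choice eig.
have [s sE] := (finite_seqP _).1 Sfin.
have [d d0 sd] := nonzero_lower_bound s (fun c => c ^+ 2 - g ^+ 2).
apply: (@no_far_eigen_seq b e d eo _ d0) => i; first by case: (bP i).
apply: sd; last by rewrite subr_eq0; case: (bP i).
suff : [set` s] (b i) by [].
rewrite -sE; split; last by case: (bP i).
exists (e i); last by case: (bP i).
apply/eqP => ei0; have := eo i.+1 i i (ltnSn i) (ltnSn i).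
by rewrite ei0 ip0l eqxx => /esym/eqP; rewrite oner_eq0.
Qed.

End Perturbation.

(** * Linear combinations of two symmetries *)

Section TwoSymmetries.
Variables (R : realType) (E : lmodType R) (f : inner_product E).
Local Notation "'[ x , y ]" := (f x y).
Local Notation "'[ x ]" := (f x x).
Variables (U1 U2 B : {linear E -> E}) (t a b : R).
Hypotheses (U1s : symmetry f U1) (U2s : symmetry f U2).
Hypothesis BE : forall x, B x = t *: x + a *: U1 x + b *: U2 x.

(** [W = U1 U2 - U2 U1] anticommutes with [U1] and [U2], hence with [B - t]. *)
Lemma commutator_reflects l x : B x = l *: x ->
  B (U1 (U2 x) - U2 (U1 x)) = (2 * t - l) *: (U1 (U2 x) - U2 (U1 x)).
Proof.
case: U1s U2s => _ UU1 [_ UU2] Bx.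
have lx : (l - t) *: x = a *: U1 x + b *: U2 x.
  by rewrite scalerBl -Bx BE; apply: (ip_ext (f := f)) => v; rewrite !ipE; ring.
have U12 : (l - t) *: U1 (U2 x) = a *: U1 (U2 (U1 x)) + b *: U1 x.
  by rewrite -!linearZZ lx !linearD !linearZZ UU2.
have U21 : (l - t) *: U2 (U1 x) = a *: U2 x + b *: U2 (U1 (U2 x)).
  by rewrite -!linearZZ lx !linearD !linearZZ UU1.
have : (l - t) *: (U1 (U2 x) - U2 (U1 x)) = t *: (U1 (U2 x) - U2 (U1 x))
     - B (U1 (U2 x) - U2 (U1 x)).
  rewrite scalerBr U12 U21 BE !linearB /= UU1 UU2.
  by apply: (ip_ext (f := f)) => v; rewrite !ipE; ring.
move=> h; apply: (ip_ext (f := f)) => v.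
have := congr1 (fun w => '[w, v]) h; rewrite /= !ipDl !ipNl !ipZl !ipDl !ipNl; lra.
Qed.

(** Where [U1] and [U2] commute, [B - t] behaves like [a (+-1) + b (+-1)]: its
    square is [a^2 + b^2 + 2 a b U1 U2], and [(U1 U2)^2 = 1], so [k = l - t]
    satisfies [(k^2 - a^2 - b^2)^2 = 4 a^2 b^2]. *)
Lemma commuting_eigenvalue l x : x != 0 -> B x = l *: x ->
  U1 (U2 x) = U2 (U1 x) -> l \in [:: t + a + b; t - a - b; t + a - b; t - a + b].
Proof.
case: U1s U2s => _ UU1 [_ UU2] x0 Bx U12.
pose k := l - t.
have kx : k *: x = a *: U1 x + b *: U2 x.
  by rewrite scalerBl -Bx BE; apply: (ip_ext (f := f)) => v; rewrite !ipE; ring.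
have k1 : k *: U1 x = a *: x + b *: U1 (U2 x).
  by rewrite -linearZZ kx linearD !linearZZ UU1.
have k2 : k *: U2 x = a *: U1 (U2 x) + b *: x.
  by rewrite -linearZZ kx linearD !linearZZ UU2 U12.
have k12 : k *: U1 (U2 x) = a *: U2 x + b *: U1 x.
  by rewrite U12 -!linearZZ kx linearD !linearZZ UU1 linearD !linearZZ U12 UU2.
(* Pairing with [x] leaves linear relations between ['[x]] and the three numbers
   ['[U1 x, x]], ['[U2 x, x]], ['[U1 (U2 x), x]]. *)
have xx := ip_gt0 f x0.
have E0 := congr1 (fun w => '[w, x]) kx; rewrite /= !ipE in E0.
have E1 := congr1 (fun w => '[w, x]) k1; rewrite /= !ipE in E1.
have E2 := congr1 (fun w => '[w, x]) k2; rewrite /= !ipE in E2.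
have E3 := congr1 (fun w => '[w, x]) k12; rewrite /= !ipE in E3.
move: ('[U1 (U2 x), x]) ('[U1 x, x]) ('[U2 x, x]) E0 E1 E2 E3 => p q r E0 E1 E2 E3.
have : ((k - a - b) * (k + a + b) * (k - a + b) * (k + a - b)) * '[x] = 0.
  set z := '[x] in E0 E1 E2 E3 *.
  have Ka : (k ^+ 2 - a ^+ 2 - b ^+ 2) * z = 2 * a * b * p.
    have -> : (k ^+ 2 - a ^+ 2 - b ^+ 2) * z = k * (k * z) - a * (a * z) - b * (b * z) by ring.
    rewrite E0; have -> : k * (a * q + b * r) = a * (k * q) + b * (k * r) by ring.
    by rewrite E1 E2; ring.
  have Kb : (k ^+ 2 - a ^+ 2 - b ^+ 2) * p = 2 * a * b * z.
    have -> : (k ^+ 2 - a ^+ 2 - b ^+ 2) * p = k * (k * p) - a * (a * p) - b * (b * p) by ring.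
    rewrite E3; have -> : k * (a * r + b * q) = a * (k * r) + b * (k * q) by ring.
    by rewrite E1 E2; ring.
  have -> : (k - a - b) * (k + a + b) * (k - a + b) * (k + a - b) * z =
     (k ^+ 2 - a ^+ 2 - b ^+ 2) * ((k ^+ 2 - a ^+ 2 - b ^+ 2) * z) - 4 * a ^+ 2 * b ^+ 2 * z by ring.
  rewrite Ka; have -> : (k ^+ 2 - a ^+ 2 - b ^+ 2) * (2 * a * b * p) =
    2 * a * b * ((k ^+ 2 - a ^+ 2 - b ^+ 2) * p) by ring.
  by rewrite Kb; ring.
move/eqP; rewrite !mulf_eq0 (gt_eqF xx) orbF !inE /k.
by case/orP => [/orP[/orP[]|]|] /eqP h; apply/or4P;
  [constructor 1|constructor 2|constructor 3|constructor 4]; apply/eqP; lra.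
Qed.

End TwoSymmetries.

(** If [l] is not in [[0, g[], then [l^2 - g^2] small means that [l] is slightly
    above [- g] (where [|l^2 - g^2| >= g (l + g)]) or slightly above [g] (where
    [|l^2 - g^2| >= (l - g)^2]). *)
Lemma near_endpoint (R : realType) (g l d e : R) : 0 <= g -> 0 < d ->
  - g <= l -> ~ (0 <= l < g) -> `|l ^+ 2 - g ^+ 2| < e ->
  e <= d ^+ 2 -> (g != 0 -> e <= d * g) ->
  exists2 s, s \in [:: g; - g] & 0 <= l - s < d.
Proof.
move=> g0 d0 gl lg; rewrite ltr_norml => /andP[h1 h2] ed eg.
have [l0|l0] := ltP l 0.
  exists (- g); first by rewrite !inE eqxx orbT.
  have gp : 0 < g by lra.
  have h := eg (lt0r_neq0 gp); apply/andP; split; nra.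
exists g; first by rewrite !inE eqxx.
have gl' : g <= l by rewrite leNgt; apply/negP => lg'; apply: lg; rewrite l0.
apply/andP; split; nra.
Qed.

(** * Incompatibility of the two spectra *)

Section Core.
Variables (R : realType) (E : lmodType R) (f : inner_product E).
Local Notation "'[ x , y ]" := (f x y).
Local Notation "'[ x ]" := (f x x).
Variables (U : set_system nat) (UF : ProperFilter U).
Hypothesis Uoo : \oo `<=` U.

(** Removing the finitely many eigenvalues of [B] at which one of the spectral
    facts fails, for the eigenvalue or for its mirror image about [t], leaves an
    eigenvalue [l] such that both [l] and [2t - l] are within [d] above [g] or
    [- g]. *)
Lemma three_symmetries_finite_span (K V U1 U2 : {linear E -> E}) (t a b g : R) :
  self_adjoint f K -> (forall x, 0 <= '[K x, x]) -> compact_along f U K ->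
  symmetry f V -> symmetry f U1 -> symmetry f U2 -> 0 <= g ->
  (forall x, K x + g *: V x = t *: x + a *: U1 x + b *: U2 x) ->
  finite_span (range K).
Proof.
move=> Ksa K0 Kc Vs U1s U2s g0 KE; apply: contrapT => Kinf.
pose B : {linear E -> E} := K \+ g \*: V.
have BE x : B x = K x + g *: V x by [].
have BU x : B x = t *: x + a *: U1 x + b *: U2 x by rewrite BE KE.
move: (B) BE BU => {}B BE BU.
have M0 : 0 <= 4 * (t ^+ 2 + a ^+ 2 + b ^+ 2 + g ^+ 2) by nra.
have KM x : '[K x] <= 4 * (t ^+ 2 + a ^+ 2 + b ^+ 2 + g ^+ 2) * '[x].
  have -> : K x = (t *: x + a *: U1 x) + (b *: U2 x - g *: V x).
    by rewrite addrA -KE addrK.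
  have := ip_parallelogram_le f (t *: x + a *: U1 x) (b *: U2 x - g *: V x).
  have := ip_parallelogram_le f (t *: x) (a *: U1 x).
  have := ip_parallelogram_le f (b *: U2 x) (- (g *: V x)).
  rewrite !ipNl !ipNr !ipZl !ipZr.
  rewrite (symmetry_isometry _ U1s) (symmetry_isometry _ U2s) (symmetry_isometry _ Vs).
  nra.
(* [d] is so small that [s + s'] within [2 d] of [2 t], for endpoints [s] and
   [s'], implies [s + s' = 2 t]. *)
have [d d0 dP] := nonzero_lower_bound [:: 2 * g; 0; - 2 * g] (fun s => t - s / 2).
pose e := if g == 0 then d ^+ 2 else Num.min (d ^+ 2) (d * g).
have e0 : 0 < e.
  rewrite /e; case: eqVneq => g1; first exact: exprn_gt0.
  by rewrite lt_min exprn_gt0 //= mulr_gt0 // lt_neqAle eq_sym g1.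
have ed : e <= d ^+ 2 by rewrite /e; case: ifP => // _; rewrite ge_min lexx.
have eg : g != 0 -> e <= d * g by rewrite /e => /negPf->; rewrite ge_min lexx orbT.
pose X := (eigenvalue_of B `&` [set l | e <= `|l ^+ 2 - g ^+ 2|]) `|`
          (eigenvalue_of B `&` [set l | 0 <= l < g]).
have Xfin : finite_set X.
  rewrite finite_setU; split.
    exact: (far_eigenvalues_finite UF Uoo Ksa Kc M0 KM Vs BE).
  exact: (gap_eigenvalues_finite UF Uoo Ksa K0 Kc Vs g0 BE).
have near l : eigenvalue_of B l -> ~ X l -> exists2 s, s \in [:: g; - g] & 0 <= l - s < d.
  move=> lB lX; apply: near_endpoint ed eg => //.
  - exact: (eigenvalue_ge K0 Vs g0 BE).
  - by move=> lg; apply: lX; right.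
  - by rewrite ltNge; apply/negP => le; apply: lX; left.
have := eigenvalues_infinite UF Uoo Ksa K0 Kc M0 KM Vs g0 BE Kinf.
have Yfin : finite_set (X `|` [set` [:: t + a + b; t - a - b; t + a - b; t - a + b]] `|`
    [set 2 * t - l | l in X]).
  rewrite finite_setU; split; last exact: finite_image.
  by rewrite finite_setU; split=> //; exact: finite_seq.
move=> /infinite_setD /(_ Yfin) /infinite_setN0 [l [[lB lg] /not_orP[/not_orP[lX lU] lX']]].
have [x x0 Bx] := lB.
have l'B : eigenvalue_of B (2 * t - l).
  exists (U1 (U2 x) - U2 (U1 x)); last exact: (commutator_reflects U1s U2s BU).
  rewrite subr_eq0; apply/eqP => U12; apply: lU.
  exact: (commuting_eigenvalue U1s U2s BU x0 Bx).
have [s sg /andP[ls0 ls1]] := near _ lB lX.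
have [|s' sg' /andP[ls0' ls1']] := near _ l'B.
  by move=> Xl; apply: lX'; exists (2 * t - l) => //; ring.
have ts : t - (s + s') / 2 = 0.
  apply/eqP/negPn/negP => /dP.
  have -> : s + s' \in [:: 2 * g; 0; - 2 * g].
    move: sg sg'; rewrite !inE => /orP[]/eqP-> /orP[]/eqP->; apply/or3P;
    [constructor 1|constructor 2|constructor 2|constructor 3]; apply/eqP; lra.
  by move=> /(_ isT); apply/negP; rewrite -ltNge ltr_norml; apply/andP; split; lra.
have ls : l = s by lra.
by move: lg; rewrite /= ls; move: sg; rewrite !inE => /orP[]/eqP->; rewrite ?sqrrN eqxx.
Qed.

End Core.

(** * The real inner product space underlying a Hilbert space *)

(** An alias of the complex vector space, so that scalar multiplication by reals
    does not compete with the one by complex numbers. *)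
Definition realified (R : realType) (H : lmodType R[i]) : Type := H.

Section Realified.
Local Open Scope complex_scope.
Variables (R : realType) (H : lmodType R[i]).

HB.instance Definition _ := GRing.Zmodule.copy (realified H) H.

Definition realified_scale (a : R) (x : realified H) : realified H :=
  a%:C *: (x : H).

Fact realified_scaleA a b x :
  realified_scale a (realified_scale b x) = realified_scale (a * b) x.
Proof. by rewrite /realified_scale scalerA rmorphM. Qed.

Fact realified_scale1 : left_id 1 realified_scale.
Proof. by move=> x; rewrite /realified_scale rmorph1 scale1r. Qed.

Fact realified_scaleDr : right_distributive realified_scale +%R.
Proof. by move=> a x y; exact: scalerDr. Qed.

Fact realified_scaleDl x : {morph realified_scale^~ x : a b / a + b}.
Proof. by move=> a b; rewrite /realified_scale rmorphD scalerDl. Qed.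

HB.instance Definition _ := GRing.Zmodule_isLmodule.Build R (realified H)
  realified_scaleA realified_scale1 realified_scaleDr realified_scaleDl.

Lemma realified_scaleE (a : R) (x : realified H) : a *: x = a%:C *: (x : H).
Proof. by []. Qed.

Definition realified_map (T : {linear H -> H}) (x : realified H) : realified H :=
  T x.

Fact realified_map_linear T : linear (realified_map T).
Proof. by move=> a x y; rewrite /realified_map linearP. Qed.

HB.instance Definition _ T :=
  GRing.isLinear.Build R (realified H) (realified H) *:%R (realified_map T)
    (realified_map_linear T).

Variable dot : {dot H for Num.conj}.

Definition real_dot (x y : realified H) : R := complex.Re (dot x y).

Lemma ReD (u v : R[i]) : complex.Re (u + v) = complex.Re u + complex.Re v.
Proof. by case: u v => ? ? []. Qed.

Lemma ReMrealc (a : R) (z : R[i]) : complex.Re (a%:C * z) = a * complex.Re z.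
Proof. by case: z => u v /=; rewrite mul0r subr0. Qed.

Fact real_dotC x y : real_dot x y = real_dot y x.
Proof. 
rewrite /real_dot hermC mul1r.
by transitivity (complex.Re (conjc (dot y x))); last by case: (dot y x).
Qed.

Fact real_dotDl x y z : real_dot (x + y) z = real_dot x z + real_dot y z.
Proof. rewrite /real_dot (linearDl dot z (x : H) (y : H)). exact: ReD. Qed.

Fact real_dotZl a x y : real_dot (a *: x) y = a * real_dot x y.
Proof. by rewrite /real_dot realified_scaleE linearZl_LR ReMrealc. Qed.

Fact real_dot_gt0 x : x != 0 -> 0 < real_dot x x.
Proof. by rewrite -(dnorm_gt0 dot) ltcE => /andP[]. Qed.

Definition real_inner_product : inner_product (realified H) :=
  InnerProduct real_dotC real_dotDl real_dotZl real_dot_gt0.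

End Realified.

(** * Orthoprojections on a Hilbert space *)

Lemma ultra_fmap (T1 T2 : Type) (h : T1 -> T2) (U : set_system T1) :
  UltraFilter U -> UltraFilter (fmap h U).
Proof.
move=> UU; split; first exact: fmap_proper_filter.
move=> G GF UG; apply/seteqP; split=> [A GA|]; last exact: UG.
have [//|hA] := in_ultra_setVsetC (h @^-1` A) UU.
by have [y []] := @filter_ex _ G _ _ (filterI GA (UG (~` A) hA)).
Qed.

Section HilbertSpace.
Local Open Scope complex_scope.
Variables (R : realType) (H : completeNormedModType R[i]).
Variables (dot : {dot H for Num.conj}) (dot_norm : induces_norm dot).
Local Notation f := (real_inner_product dot).

Lemma sqr_norm_real_dot (x : H) : `|x| ^+ 2 = (f x x)%:C.
Proof.
by rewrite dot_norm -[LHS]RRe_real // ger0_real // dnorm_ge0.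
Qed.

Lemma compact_operator_along (U : set_system nat) (K : {linear H -> H}) :
  UltraFilter U -> compact_operator K -> compact_along f U (realified_map K).
Proof.
move=> UU Kc x M xM; have UF := @ultra_proper _ _ UU.
have xbd : bounded_set (range (x : nat -> H)).
  have M1 : 0 <= 1 + `|M| by rewrite addr_ge0.
  exists (1 + `|M|)%:C; split; first by rewrite ger0_real // lecR.
  move=> k /ltW Mk _ [n _ <-]; apply: le_trans Mk.
  rewrite -(@ler_pXn2r _ 2) ?nnegrE ?lecR //.
  rewrite sqr_norm_real_dot -rmorphXn lecR; apply: le_trans (xM n) _.
  by have := ler_norm M; have := normr_ge0 M; nra.
have := Kc _ xbd; rewrite precompactE compact_ultra.
move=> /(_ (fmap (fun n => K (x n)) U) (ultra_fmap _ UU)) [].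
  apply: (@filterS nat U _ setT _ _ filterT) => n _; apply: subset_closure.
  by exists (x n) => //; exists n.
move=> l [_ Kl]; exists (l : realified H) => e e0.
have s0 : 0 < (Num.sqrt e)%:C by rewrite ltcR sqrtr_gt0.
have /cvgrPdist_lt/(_ _ s0) := Kl.
apply: filterS => n; rewrite distrC => Kn; rewrite /mkset -ltcR.
rewrite -[X in X < _](sqr_norm_real_dot (K (x n) - l)).
rewrite -[e]sqr_sqrtr ?ltW // rmorphXn.
by rewrite ltr_pXn2r ?nnegrE // ltW.
Qed.

Lemma finite_span_realified (A : set (realified H)) :
  finite_span A -> finitely_spanned (A : set H).
Proof.
move=> [n [v vA]]; exists n, v => x /vA [a ->].
by exists (fun k => (a k)%:C).
Qed.

Lemma selfadjoint_realified (T : {linear H -> H}) :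
  selfadjoint dot T -> self_adjoint f (realified_map T).
Proof. by move=> Tsa x y; congr complex.Re; exact: Tsa. Qed.

Lemma orthoprojection_symmetry (P : {linear H -> H}) : orthoprojection dot P ->
  exists2 V : {linear realified H -> realified H}, symmetry f V &
    forall x, realified_map P x = 2^-1 *: (x + V x).
Proof.
move=> [_ /selfadjoint_realified Psa PP].
have [V VE] : exists V : {linear realified H -> realified H},
    forall x, V x = 2 *: realified_map P x - x.
  by exists (2 \*: realified_map P \- idfun).
exists V; first split.
- by move=> x y; rewrite !VE !ipE Psa.
- move=> x; rewrite VE {1}VE linearB linearZZ /=.
  have -> : realified_map P (realified_map P x) = realified_map P x by exact: PP.
  by rewrite VE; apply: (ip_ext (f := f)) => w; rewrite !ipE; ring.
by move=> x; rewrite VE; apply: (ip_ext (f := f)) => w; rewrite !ipE; field.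
Qed.

(** With [D] and [D'] the differences of the two sides of the claimed
    identities, both selfadjoint, the hypothesis reads [D = i D']. Then
    [i '[D' x, y] = '[D x, y] = '[x, D y] = - i '[x, D' y] = - i '[D' x, y]],
    so [D' = 0]. *)
Lemma cartesian_decomposition (T S : {linear H -> H}) (n : nat)
    (c : 'I_n -> R[i]) (P : 'I_n -> {linear H -> H}) :
  selfadjoint dot T -> selfadjoint dot S -> (forall j, selfadjoint dot (P j)) ->
  (forall x, T x - 'i *: S x = \sum_(j < n) c j *: P j x) ->
  (forall x : realified H, realified_map T x =
     \sum_(j < n) complex.Re (c j) *: realified_map (P j) x) /\
  (forall x : realified H, realified_map S x =
     - \sum_(j < n) complex.Im (c j) *: realified_map (P j) x).
Proof.
move=> Tsa Ssa Psa TS.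
pose A x := \sum_(j < n) (complex.Re (c j))%:C *: P j x.
pose C x := \sum_(j < n) (complex.Im (c j))%:C *: P j x.
have sum_sa (r : 'I_n -> R) x y :
    dot (\sum_(j < n) (r j)%:C *: P j x) y = dot x (\sum_(j < n) (r j)%:C *: P j y).
  rewrite linear_sumlz linear_sumr; apply: eq_bigr => j _.
  rewrite linearZl_LR linearZr_LR /= Psa; congr (_ * _).
  by rewrite -[RHS]/(conjc _) conjc_real.
have TSE x : T x - A x = 'i *: (S x + C x).
  have -> : T x = \sum_(j < n) c j *: P j x + 'i *: S x by rewrite -TS subrK.
  rewrite scalerDr addrAC addrC -sumrB scaler_sumr; congr (_ + _).
  by apply: eq_bigr => j _; rewrite -scalerBl scalerA {1}[c j]complexE addrC addKr.
have TA_sa x y : dot (T x - A x) y = dot x (T y - A y).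
  by rewrite linearBl linearBr /= Tsa sum_sa.
have SC_sa x y : dot (S x + C x) y = dot x (S y + C y).
  by rewrite linearDl linearDr /= Ssa sum_sa.
have i_conj_cancel (d : R[i]) : 'i * d = Num.conj 'i * d -> d = 0.
  have -> : Num.conj 'i = - 'i :> R[i].
    by apply/eqP; rewrite eq_complex /= oppr0 !eqxx.
  have i_neq0 : 'i != 0 :> R[i] by rewrite eq_complex /= oner_eq0 andbF.
  move/eqP; rewrite mulNr -addr_eq0 -mulr2n mulrn_eq0 mulf_eq0.
  by rewrite (negPf i_neq0) => /eqP.
have SC x : S x + C x = 0.
  apply/eqP/negPn/negP; rewrite -(dnorm_gt0 dot).
  have := TA_sa x (S x + C x); rewrite !TSE linearZl_LR linearZr_LR /=.
  by rewrite -(SC_sa x) => /i_conj_cancel ->; rewrite ltxx.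
split=> x.
  by apply/eqP; rewrite -subr_eq0 -[X in X == _]/(T x - A x) TSE SC scaler0.
by apply/eqP; rewrite -addr_eq0; apply/eqP; exact: SC.
Qed.

(** Orthoprojections are [(1 + U) / 2] with [U] a symmetry, so they turn into
    symmetries at the cost of changing the scalar [s]. *)
Lemma three_orthoprojections_finite_rank (K : {linear H -> H}) (s : R)
    (k : 'I_3 -> R) (P : 'I_3 -> {linear H -> H}) :
  selfadjoint dot K -> nonnegative dot K -> compact_operator K ->
  (forall j, orthoprojection dot (P j)) ->
  (forall x : realified H, realified_map K x + s *: x =
     \sum_(j < 3) k j *: realified_map (P j) x) ->
  finitely_spanned (range K).
Proof.
move=> Ksa K0 Kc Porth KE.
have [U [UU Uoo]] := @ultraFilterLemma nat \oo _.
have [U1 U1s P1] := orthoprojection_symmetry (Porth 0).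
have [U2 U2s P2] := orthoprojection_symmetry (Porth 1).
have [U3 U3s P3] := orthoprojection_symmetry (Porth 2%:R).
have K0' x : 0 <= f (realified_map K x) x.
  by have := K0 x; rewrite lecE => /andP[].
pose t := (k 0 + k 1 + k 2%:R) / 2 - s.
have KE' x : realified_map K x = t *: x + (k 0 / 2) *: U1 x + (k 1 / 2) *: U2 x
    + (k 2%:R / 2) *: U3 x.
  have -> : realified_map K x = \sum_(j < 3) k j *: realified_map (P j) x - s *: x.
    by rewrite -KE addrK.
  rewrite !big_ord_recl big_ord0.
  have -> : lift ord0 ord0 = 1 :> 'I_3 by apply/val_inj.
  have -> : lift ord0 (lift ord0 ord0) = 2%:R :> 'I_3 by apply/val_inj.
  rewrite P1 P2 P3 /t.
  by apply: (ip_ext (f := f)) => w; rewrite !ipE; field.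
(* The third symmetry goes to the left; its sign is chosen so as to make the
   coefficient nonnegative. *)
have [V Vs [g g0 gV]] : exists2 V : {linear realified H -> realified H},
    symmetry f V & exists2 g, 0 <= g & forall x, g *: V x = - ((k 2%:R / 2) *: U3 x).
  have [k0|k0] := leP (k 2%:R) 0.
    exists U3 => //; exists (- (k 2%:R / 2)); last by move=> x; rewrite scaleNr.
    by rewrite oppr_ge0 pmulr_lle0 ?invr_gt0.
  have [V VE] : exists V : {linear realified H -> realified H}, forall x, V x = - U3 x.
    by exists (\- U3).
  exists V; last first.
    by exists (k 2%:R / 2) => [|x]; rewrite ?VE ?scalerN // divr_ge0 // ltW.
  case: U3s => U3sa UU3; split=> [x y|x]; first by rewrite !VE !ipE U3sa.
  by rewrite !VE linearN UU3 opprK.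
apply: finite_span_realified.
apply: (three_symmetries_finite_span (@ultra_proper _ _ UU) Uoo (K := realified_map K)
  (selfadjoint_realified Ksa) K0' (compact_operator_along UU Kc) Vs U1s U2s g0).
by move=> x; apply/eqP; rewrite gV subr_eq; apply/eqP; exact: KE'.
Qed.

End HilbertSpace.

Theorem corollary4p4 (R : realType) (H : completeNormedModType R[i])
    (dot : {dot H for Num.conj}) (dot_norm : induces_norm dot)
    (H_separable : separable H) (H_infinite : infinite_dimensional H)
    (K : {linear H -> H}) (K_selfadjoint : selfadjoint dot K)
    (K_ge0 : nonnegative dot K) (K_compact : compact_operator K)
    (K_infinite_rank : infinite_rank K) :
  ~ exists (c : 'I_4 -> R[i]) (P : 'I_4 -> {linear H -> H}),
      (forall j, orthoprojection dot (P j)) /\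
      (forall x : H, x - K x - 'i%C *: K x = \sum_(j < 4) c j *: P j x).
Proof.
move=> [c [P [Porth cP]]]; apply: K_infinite_rank.
have Psa j : selfadjoint dot (P j) by case: (Porth j).
have [T TE] : exists T : {linear H -> H}, forall x, T x = x - K x.
  by exists (idfun \- K).
have Tsa : selfadjoint dot T.
  by move=> x y; rewrite !TE linearBl linearBr /= K_selfadjoint.
have TP' x : T x - 'i%C *: K x = \sum_(j < 4) c j *: P j x by rewrite TE.
have [TP KP] := cartesian_decomposition Tsa K_selfadjoint Psa TP'.
pose d j := complex.Re (c j) - complex.Im (c j).
have xP (x : realified H) : x = \sum_(j < 4) d j *: realified_map (P j) x.
  transitivity (realified_map T x + realified_map K x).
    by rewrite /realified_map TE subrK.
  by rewrite TP KP -sumrB; apply: eq_bigr => j _; rewrite scalerBl.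
have [dj0|[j dj]] : (forall j, d j = 0) \/ exists j, d j != 0.
  have [h|/existsNP[j /eqP]] := pselect (forall j, d j = 0); first by left.
  by right; exists j.
  exists 0%N, (fun=> 0) => x _; exists (fun=> 0).
  by rewrite big_ord0 (xP x) big1 // => j _; rewrite dj0 scale0r.
(* [K - s] then has coefficient [- Im (c j) - s * d j = 0] at [P j]. *)
pose s := - complex.Im (c j) / d j.
apply: (@three_orthoprojections_finite_rank _ _ _ _ K (- s)
  (fun i => - complex.Im (c (lift j i)) - s * d (lift j i)) (fun i => P (lift j i))) => // x.
have sx : - s *: x = \sum_(i < 4) (- s * d i) *: realified_map (P i) x.
  rewrite {1}(xP x) scaler_sumr; apply: eq_bigr => i _.
  by rewrite scalerA.
rewrite KP sx -sumrN -big_split (bigD1_ord j) //=.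
rewrite -scaleNr -scalerDl (_ : - complex.Im (c j) + _ = 0) ?scale0r ?add0r; last first.
  by rewrite mulNr /s mulfVK // opprK addNr.
by apply: eq_bigr => i _; rewrite -scaleNr -scalerDl mulNr.
Qed.
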